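(* The $C(\lambda)$-typical function is leo; that is, there is a dense $G_\delta$ subset $G$ of the metric space $(C(\lambda),\rho)$ such that every $f\in G$ is leo (locally eventually onto).
   Context: $\lambda$ is the Lebesgue measure on $[0,1]$, $\mathcal B$ the Borel $\sigma$-algebra of $[0,1]$. $C(\lambda)$ is the set of all continuous maps $f\colon[0,1]\to[0,1]$ with $\lambda(A)=\lambda(f^{-1}(A))$ for all $A\in\mathcal B$, equipped with the complete metric $\rho(f,g)=\sup_{x\in[0,1]}|f(x)-g(x)|$. A map $f\in C(\lambda)$ is leo (locally eventually onto) if for every nonempty open set $U\subset[0,1]$ there is $n\in\mathbb N$ such that $f^n(U)=[0,1]$. *)

(* Defs.v *)
From HB Require Import structures.
From mathcomp Require Import all_boot all_order all_algebra.
From mathcomp Require Import lra.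
From mathcomp Require Import all_classical all_reals all_analysis.

Set Implicit Arguments.
Unset Strict Implicit.
Unset Printing Implicit Defensive.

Import Order.TTheory GRing.Theory Num.Theory.
Import numFieldNormedType.Exports.

Local Open Scope classical_set_scope.
Local Open Scope ring_scope.

(* The closed interval [0, 1] as a type; its topology is the subspace topology
   that the library puts on every set_type. *)
Notation unit_interval R := (set_type `[0 : R, 1]%classic).

Definition borel_unit (R : realType) : set (set (unit_interval R)) :=
  <<s [set U : set (unit_interval R) | open U] >>.

Definition lambda_unit (R : realType) (A : set (unit_interval R)) : \bar R :=
  lebesgue_measure (val @` A : set R).

Definition preserves_lambda (R : realType)
    (f : unit_interval R -> unit_interval R) : Prop :=
  forall A, borel_unit A -> lambda_unit A = lambda_unit (f @^-1` A).

(* A record rather than a subtype of the function type, so that the pointwise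
   topology of the latter is not inherited: the only topology on C_lambda R is
   the one of the uniform distance, installed below. *)
Record C_lambda (R : realType) : Type := MkC_lambda {
  C_lambda_fun :> unit_interval R -> unit_interval R ;
  C_lambda_continuous : continuous C_lambda_fun ;
  C_lambda_preserves : preserves_lambda C_lambda_fun
}.

Definition rho (R : realType) (f g : C_lambda R) : R :=
  sup [set `|val (f x) - val (g x)| | x in [set: unit_interval R]].

Section rho_metric.
Context {R : realType}.
Implicit Types f g h : C_lambda R.

Let dist_le1 (u v : unit_interval R) : `|val u - val v| <= 1.
Proof.
have /set_mem := valP u; have /set_mem := valP v.
rewrite /= !in_itv/= => /andP[v0 v1] /andP[u0 u1].
by rewrite ler_norml; apply/andP; split; lra.
Qed.

Let dists_has_sup f g :
  has_sup [set `|val (f x) - val (g x)| | x in [set: unit_interval R]].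
Proof.
have i0 : (0 : R) \in `[0 : R, 1]%classic by rewrite inE/= in_itv/= lexx ler01.
split; first by eexists; exists (exist _ 0 i0).
by exists 1 => _ [x _ <-]; exact: dist_le1.
Qed.

Let le_rho f g x : `|val (f x) - val (g x)| <= rho f g.
Proof. by apply: sup_upper_bound (dists_has_sup f g) _ _; exists x. Qed.

Let rho_le f g (e : R) :
  (forall x, `|val (f x) - val (g x)| <= e) -> rho f g <= e.
Proof.
move=> fge; apply: ge_sup; first by case: (dists_has_sup f g).
by move=> _ [x _ <-].
Qed.

Let rhoxx f : rho f f = 0.
Proof.
have [[_ [x _ _]] _] := dists_has_sup f f.
apply/eqP; rewrite eq_le (le_trans _ (le_rho f f x)) ?normr_ge0// andbT.
by apply: rho_le => y; rewrite subrr normr0.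
Qed.

Let rho_positivity f g : rho f g = 0 -> f = g.
Proof.
move=> fg0.
have fg : C_lambda_fun f = C_lambda_fun g.
  apply/funext => x; apply/val_inj/eqP; rewrite -subr_eq0 -normr_le0.
  by apply: le_trans (le_rho f g x) _; rewrite fg0.
case: f g fg {fg0} => [f cf pf] [g cg pg] /= fg; subst g.
by congr MkC_lambda; exact: Prop_irrelevance.
Qed.

Let rho_sym f g : rho f g = rho g f.
Proof.
by rewrite /rho; congr sup; apply: eq_imagel => x _; rewrite distrC.
Qed.

Let rho_triangle g f h : rho f h <= rho f g + rho g h.
Proof.
apply: rho_le => x; rewrite (le_trans (ler_distD (val (g x)) _ _))//.
by rewrite lerD ?le_rho.
Qed.

HB.instance Definition _ := gen_eqMixin (C_lambda R).
HB.instance Definition _ := gen_choiceMixin (C_lambda R).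
HB.instance Definition _ := @isMetric.Build R (C_lambda R)
  (@rho R) rhoxx rho_positivity rho_sym rho_triangle.

End rho_metric.

Definition leo (R : realType) (f : unit_interval R -> unit_interval R) : Prop :=
  forall U : set (unit_interval R), open U -> U !=set0 ->
    exists n : nat, iter n f @` U = [set: unit_interval R].

(* Main.v *)
Require Import Defs.
From HB Require Import structures.
From mathcomp Require Import all_boot all_order all_algebra.
From mathcomp Require Import lra.
From mathcomp Require Import all_classical all_reals all_analysis.
From mathcomp Require Import measurable_realfun borel_hierarchy.

Set Implicit Arguments.
Unset Strict Implicit.
Unset Printing Implicit Defensive.

Import Order.TTheory GRing.Theory Num.Theory.
Import numFieldNormedType.Exports.

Local Open Scope classical_set_scope.
Local Open Scope ring_scope.

(** Call a map expanding at scale w when the image of every segment [p, q] of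
    length at least w is longer than [p, q] by some fixed c > 0, except that
    nothing is asked of a segment with p < w and 1 - w < q.  Iterating an
    expanding map on a segment of length at least w adds c to the length at each
    step, so after finitely many steps the image contains [w, 1 - w]
    ([expands_iter]).  If moreover neither 0 nor 1 is sent to 0 or 1, then 0 and
    1 are taken at interior points, so f maps [w, 1 - w] onto [0, 1] for small w
    ([inner_ends_covers]), and one more step covers everything.  Hence a map
    which is expanding at every scale 1/(N+1) and sends the endpoints into the
    open interval is leo ([leo_of_expands]).  These conditions are countably many
    and each is open for the uniform distance; if each is dense, the Baire
    property of C(lambda) ([C_lambda_Baire]) gives the dense G_delta.

    Density comes from composing a given f with some h in C(lambda) uniformly
    close to the identity; f o h stays close to f by uniform continuity.  The key
    remark is that no f in C(lambda) shortens segments: [p, q] lies in the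
    preimage of its image [m, M], which has measure M - m
    ([exists_spread]).  It is therefore enough to find h near the identity which
    lengthens segments itself.  Cut [0, 1] into blocks of length w and replace
    the identity on each block by a zigzag with three laps of slope 3, -3, 3.
    The image of a segment of length at least w contains the segment, and its
    endpoints are pushed outwards unless they are close to an end of a block.
    Composing two such maps, whose blocks are shifted by w/2, pushes every
    endpoint outwards, apart from those close to 0 or 1 ([exists_expanding]).
    For the endpoints one folds a small neighbourhood of 0, or of 1, so that the
    endpoint goes to a chosen nearby point where f is neither 0 nor 1.

    Membership in C(lambda) is read off from superlevel sets: a continuous f
    preserves lambda as soon as the set where f >= t has measure 1 - t for each t
    ([preserves_of_levels]).  This settles both the piecewise affine maps and the
    uniform limits needed for completeness. *)

(** * Self-maps of the unit interval as real functions *)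

Section Extension.
Context {R : realType}.
Implicit Types (x y t : R) (u : unit_interval R).
Implicit Types (f g : unit_interval R -> unit_interval R).

Lemma clamp_subproof x : Num.max 0 (Num.min x 1) \in `[0 : R, 1]%classic.
Proof.
by rewrite inE/= in_itv/= le_max lexx/= ge_max ler01 ge_min lexx orbT.
Qed.

Definition clamp x : unit_interval R :=
  exist (fun y : R => y \in `[0, 1]%classic) _ (clamp_subproof x).

(** Precomposing with the retraction of R onto [0, 1] turns f into a total,
    globally continuous real function, so that real analysis applies without
    relative topologies. *)
Definition ext f x : R := val (f (clamp x)).

Lemma val_clamp x : 0 <= x <= 1 -> val (clamp x) = x.
Proof. by move=> /andP[x0 x1] /=; rewrite min_l// max_r. Qed.

Lemma unit_ge0_le1 u : 0 <= val u <= 1.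
Proof. by have /set_mem := valP u; rewrite /= in_itv. Qed.

Lemma clamp_val u : clamp (val u) = u.
Proof. by apply: val_inj; rewrite val_clamp// unit_ge0_le1. Qed.

Lemma ext_val f u : ext f (val u) = val (f u).
Proof. by rewrite /ext clamp_val. Qed.

Lemma ext_ge0_le1 f x : 0 <= ext f x <= 1.
Proof. exact: unit_ge0_le1. Qed.

Lemma ext_comp f g x : ext (f \o g) x = ext f (ext g x).
Proof. by rewrite ext_val. Qed.

Lemma continuous_clamp : continuous clamp.
Proof.
apply: continuous_comp_initial => x.
rewrite (_ : _ \o _ = (fun=> 0) \max (id \min (fun=> 1))) //.
apply: continuous_max; first exact: cvg_cst.
by apply: continuous_min; [exact: cvg_id|exact: cvg_cst].
Qed.

Lemma continuous_unit_val : continuous (val : unit_interval R -> R).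
Proof. exact: initial_continuous. Qed.

Lemma continuous_ext f : continuous f -> continuous (ext f).
Proof.
move=> cf x; apply: (@continuous_comp _ _ _ (f \o clamp) val).
  by apply: continuous_comp; [exact: continuous_clamp|exact: cf].
exact: continuous_unit_val.
Qed.

Lemma continuous_ext_inv f : continuous (ext f) -> continuous f.
Proof.
move=> cf; apply: continuous_comp_initial.
rewrite (_ : _ \o _ = ext f \o val); last first.
  by apply/funext => u /=; rewrite ext_val.
by move=> u; apply: continuous_comp; [exact: continuous_unit_val|exact: cf].
Qed.

End Extension.

(** * Preservation of the Lebesgue measure and superlevel sets *)

Section Levels.
Context {R : realType}.
Implicit Types (x y t : R) (u : unit_interval R).
Implicit Types (f g : unit_interval R -> unit_interval R).

Lemma image_val_preimage f (B : set R) :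
  val @` (f @^-1` (val @^-1` B)) = ext f @^-1` B `&` `[0, 1].
Proof.
apply/seteqP; split=> [_ [u Bu <-]|x [/= Bx]].
  by split; [rewrite /= ext_val|rewrite /= in_itv/= unit_ge0_le1].
by rewrite in_itv/= => x01; exists (clamp x) => //; rewrite val_clamp.
Qed.

Lemma image_val_preimage_val (B : set R) :
  val @` (val @^-1` B : set (unit_interval R)) = B `&` `[0, 1].
Proof.
rewrite (image_val_preimage id); apply/seteqP; split=> x /= [];
  by rewrite in_itv/= /ext => + x01; rewrite val_clamp// => ?; split.
Qed.

Lemma borel_unit_preimage (A : set (unit_interval R)) : borel_unit A ->
  exists2 B : set R, measurable B & A = val @^-1` B.
Proof.
apply: (@smallest_sub _ _ _ [set A : set (unit_interval R) |
  exists2 B : set R, measurable B & A = val @^-1` B]).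
  split=> /=; first by exists set0; [exact: measurable0|rewrite preimage_set0].
    move=> _ [B mB ->]; exists (~` B); first exact: measurableC.
    by rewrite setTD preimage_setC.
  move=> F FB.
  have /choice[B /all_and2[mB {}FB]] :
      forall n, exists B : set R, measurable B /\ F n = val @^-1` B.
    by move=> n; have [B mB FnB] := FB n; exists B.
  exists (\bigcup_i B i); first exact: bigcupT_measurable.
  by rewrite preimage_bigcup; apply: eq_bigcupr => i _; exact: FB.
by move=> _ [B oB <-]; exists B => //; exact: open_measurable.
Qed.

Lemma open_borel_unit (A : set (unit_interval R)) : open A -> borel_unit A.
Proof. exact: sub_gen_smallest. Qed.

Lemma closed_borel_unit (A : set (unit_interval R)) : closed A -> borel_unit A.
Proof.
move=> cA; have [_ /(_ (~` A))] :=
  smallest_sigma_algebra setT [set U : set (unit_interval R) | open U].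
rewrite setTD setCK => + _; apply; apply: open_borel_unit.
exact: closed_openC.
Qed.

Lemma lebesgue_segment (a b : R) : a <= b ->
  lebesgue_measure (`[a, b] : set R) = (b - a)%:E.
Proof.
rewrite le_eqVlt => /predU1P[->|ab].
  by rewrite set_itv1 lebesgue_measure_set1 subrr.
by rewrite lebesgue_measure_itv/= lte_fin ab.
Qed.

Lemma measurable_ext_segment f (a b : R) : continuous f ->
  measurable (ext f @^-1` `[a, b] `&` `[0, 1] : set (measurableTypeR R)).
Proof.
move=> cf; apply: measurableI; last exact: measurable_itv.
rewrite -[X in measurable X]setTI.
by apply: (continuous_measurable_fun (continuous_ext cf)).
Qed.

Lemma preserves_segment f a b : continuous f -> preserves_lambda f ->
  0 <= a -> a <= b -> b <= 1 ->
  lebesgue_measure (ext f @^-1` `[a, b] `&` `[0, 1] : set R) = (b - a)%:E.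
Proof.
move=> cf pf a0 ab b1; rewrite -image_val_preimage.
have /pf : borel_unit (val @^-1` `[a, b] : set (unit_interval R)).
  apply: closed_borel_unit; apply: closed_comp => [u _|].
    exact: continuous_unit_val.
  exact: interval_closed.
rewrite /lambda_unit => <-; rewrite image_val_preimage_val -lebesgue_segment//.
congr (lebesgue_measure _); apply/seteqP; split => x /=; rewrite !in_itv/=; lra.
Qed.

(** Both sides of the defining identity are finite measures of the trace of A on
    R, and the half-lines [t, +oo[ form a generating class stable under
    intersection; so they agree once they agree on half-lines. *)
Lemma preserves_of_levels f : continuous f ->
  (forall t, 0 <= t <= 1 ->
    lebesgue_measure (ext f @^-1` `[t, 1] `&` `[0, 1] : set R) = (1 - t)%:E) ->
  preserves_lambda f.
Proof.
move=> cf lf A /borel_unit_preimage[B mB ->].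
rewrite /lambda_unit image_val_preimage_val image_val_preimage.
have mI : measurable (`[0, 1] : set R) by exact: measurable_itv.
have mext : measurable_fun [set: measurableTypeR R]
    (ext f : measurableTypeR R -> measurableTypeR R).
  by apply: continuous_measurable_fun; exact: continuous_ext.
pose m1 : {measure set (measurableTypeR R) -> \bar R} :=
  mrestr (@lebesgue_measure R) mI.
pose m2 : {measure set (measurableTypeR R) -> \bar R} :=
  pushforward m1 (ext f : measurableTypeR R -> measurableTypeR R).
suff: m1 B = m2 mext B by [].
apply: (@measure_unique _ R (measurableTypeR R) (@RGenCInfty.G R)
  (fun n => `[- n%:R, +oo[%classic) _ _ _ _ m1 (m2 mext)) => //.
- exact: RGenCInfty.measurableE.
- move=> _ _ [x ->] [y ->]; exists (Num.max x y); apply/seteqP; split => z /=.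
    by rewrite !in_itv/= !andbT ge_max => -[-> ->].
  by rewrite !in_itv/= !andbT ge_max => /andP[-> ->].
- by move=> n; exists (- n%:R).
- rewrite -subTset => x _; exists (Num.truncn `|x|).+1 => //=.
  rewrite in_itv/= andbT.
  rewrite lerNl; apply/ltW/(le_lt_trans (ler_norm _)); rewrite normrN.
  by rewrite truncnS_gt.
- move=> _ [t ->]; rewrite /m2 /= /pushforward /m1 /= /mrestr.
  have [t0|t0] := ltP t 0.
    congr (lebesgue_measure _); apply/seteqP; split => x /=; rewrite !in_itv/=;
      by have := ext_ge0_le1 f x; lra.
  have [t1|t1] := ltP 1 t.
    congr (lebesgue_measure _); apply/seteqP; split => x /=; rewrite !in_itv/=;
      by have := ext_ge0_le1 f x; lra.
  transitivity (1 - t)%:E.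
    rewrite -lebesgue_segment//; congr (lebesgue_measure _).
    by apply/seteqP; split => x /=; rewrite !in_itv/=; lra.
  rewrite -lf ?t0//; congr (lebesgue_measure _); apply/seteqP; split => x /=;
   rewrite !in_itv/=; have := ext_ge0_le1 f x; lra.
move=> k; apply: (@le_lt_trans _ _ (lebesgue_measure (`[0, 1] : set R))).
  by apply: le_measure; rewrite ?inE //; apply: measurableI;
    exact: measurable_itv.
by rewrite lebesgue_segment ?ler01// ltry.
Qed.

End Levels.

(** * The uniform distance: completeness and the Baire property *)

Section Uniform_distance.
Context {R : realType}.
Implicit Types (x y t e : R) (f g h : C_lambda R).

Lemma le_rho f g x : `|ext f x - ext g x| <= rho f g.
Proof.
apply: ub_le_sup; last by exists (clamp x).
by exists 1 => _ [u _ <-]; have := unit_ge0_le1 (f u);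
  have := unit_ge0_le1 (g u); rewrite ler_norml; lra.
Qed.

Lemma rho_le f g e :
  (forall x, 0 <= x <= 1 -> `|ext f x - ext g x| <= e) -> rho f g <= e.
Proof.
move=> fge; apply: ge_sup.
  by exists `|val (f (clamp 0)) - val (g (clamp 0))|, (clamp 0).
by move=> _ [u _ <-]; rewrite -!ext_val; apply: fge; exact: unit_ge0_le1.
Qed.

Lemma rho_triangle g f h : rho f h <= rho f g + rho g h.
Proof. exact: (@metric_triangle R (C_lambda R)). Qed.

Lemma rhoxx f : rho f f = 0.
Proof. exact: (@mdistxx R (C_lambda R)). Qed.

Lemma open_rhoP (U : set (C_lambda R)) :
  open U <-> (forall f, U f -> exists2 e, 0 < e & forall g, rho f g < e -> U g).
Proof.
split=> [oU f Uf|oU].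
  have /nbhs_ballP[e e0 fU] := open_nbhs_nbhs (conj oU Uf).
  by exists e => // g fg; exact: fU.
rewrite openE => f /oU[e e0 fU]; apply/nbhs_ballP.
by exists e.
Qed.

Lemma open_closed_ball (U : set (C_lambda R)) f : open U -> U f ->
  exists2 e, 0 < e & forall g, rho f g <= e -> U g.
Proof.
move=> /open_rhoP oU /oU[e e0 fU]; exists (e / 2); first by rewrite divr_gt0.
by move=> g fg; apply: fU; apply: le_lt_trans fg _; lra.
Qed.

Lemma uniform_limit_continuous (F : R -> R) :
  (forall e, 0 < e ->
    exists2 f, continuous (ext f) & forall x, `|F x - ext f x| <= e) ->
  continuous F.
Proof.
move=> Flim x; apply/cvgrPdist_lt => e e0.
have [f cf Ff] := Flim (e / 3) ltac:(lra).
have /cvgrPdist_lt/(_ (e / 3) ltac:(lra)) := cf x.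
apply: filterS => y; have := Ff x; have := Ff y.
rewrite !ltr_norml !ler_norml; lra.
Qed.

(** If f is e-close to F then the set where F >= t lies between the sets where
    f >= t + e and f >= t - e, whose measures differ from 1 - t by at most e. *)
Lemma uniform_limit_preserves (F : unit_interval R -> unit_interval R) :
  continuous F ->
  (forall e, 0 < e -> exists f, forall x, `|ext F x - ext f x| <= e) ->
  preserves_lambda F.
Proof.
move=> cF Flim; apply: preserves_of_levels => // t /andP[t0 t1].
have cC f : continuous f by exact: C_lambda_continuous.
have pC f : preserves_lambda f by exact: C_lambda_preserves.
apply/eqP; rewrite eq_le; apply/andP; split; apply/lee_addgt0Pr => e e0;
  have [f Ff] := Flim e e0.
- pose a := Num.max 0 (t - e).
  have [a0 ate a1 ta] : [/\ 0 <= a, t - e <= a, a <= 1 & a <= t].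
    by rewrite /a; case: (lerP 0 (t - e)) => *; split; lra.
  apply: (@le_trans _ _ (1 - a)%:E); last by rewrite -EFinD lee_fin; lra.
  rewrite -(preserves_segment (cC f) (pC f) a0 a1)//.
  apply: le_measure; rewrite ?inE; do ?exact: measurable_ext_segment.
  move=> x [/=]; rewrite !in_itv/= => Fx x01; split => //.
  have := ext_ge0_le1 f x; have := Ff x; rewrite /a; rewrite ler_norml.
  by case: (lerP 0 (t - e)) => *; lra.
- have [te|te] := ltP 1 (t + e).
    apply: (@le_trans _ _ (0 + e%:E)%E); first by rewrite add0e lee_fin; lra.
    by rewrite leeD2r.
  apply: (@le_trans _ _ ((1 - (t + e))%:E + e%:E)%E).
    by rewrite -EFinD lee_fin; lra.
  have te0 : 0 <= t + e by lra.
  rewrite leeD2r// -(preserves_segment (cC f) (pC f) te0 te)//.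
  apply: le_measure; rewrite ?inE; do ?exact: measurable_ext_segment.
  move=> x [/=]; rewrite !in_itv/= => fx x01; split => //.
  by have := ext_ge0_le1 F x; have := Ff x; move: fx; rewrite ler_norml; lra.
Qed.

(** Completeness in the form used with nested balls: the u m with m >= n lie in
    the ball of radius r n about u n, and the limit lies in all these balls. *)
Lemma C_lambda_complete (u : nat -> C_lambda R) (r : nat -> R) :
  (forall n m, (n <= m)%N -> rho (u n) (u m) <= r n) ->
  (forall e, 0 < e -> exists n, r n < e) ->
  exists f, forall n, rho (u n) f <= r n.
Proof.
move=> ur r0.
have uB n m x : ext (u m) x - r m <= ext (u n) x + r n.
  have nk := le_trans (le_rho _ _ x) (ur _ _ (leq_maxl n m)).
  have mk := le_trans (le_rho _ _ x) (ur _ _ (leq_maxr n m)).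
  by move: nk mk; rewrite !ler_norml; lra.
(* By [uB] every u n x - r n is below every u m x + r m, so that the supremum
   is the pointwise limit and comes with its rate of convergence [uL]. *)
pose L x := sup (range (fun n => ext (u n) x - r n)).
have uL n x : ext (u n) x - r n <= L x <= ext (u n) x + r n.
  apply/andP; split.
    apply: ub_le_sup; last by exists n.
    by exists (ext (u n) x + r n) => _ [m _ <-].
  apply: ge_sup; first by exists (ext (u n) x - r n), n.
  by move=> _ [m _ <-].
have L01 x : 0 <= L x <= 1.
  apply/andP; split; apply/ler_addgt0Pr => e /r0[n rn].
    by have := uL n x; have := ext_ge0_le1 (u n) x; lra.
  by have := uL n x; have := ext_ge0_le1 (u n) x; lra.
pose F (v : unit_interval R) := clamp (L (val v)).
have extF x : ext F x = L x.
  rewrite {1}/ext /F val_clamp ?L01// /L; congr sup; apply: eq_imagel => n _.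
  by rewrite /ext clamp_val.
have Flim e : 0 < e -> exists f, forall x, `|ext F x - ext f x| <= e.
  move=> /r0[n rn]; exists (u n) => x; rewrite extF ler_norml.
  by have := uL n x; lra.
have cF : continuous F.
  apply: continuous_ext_inv; apply: uniform_limit_continuous => e /Flim[f Ff].
  by exists f => //; apply: continuous_ext; exact: C_lambda_continuous.
exists (MkC_lambda cF (uniform_limit_preserves cF Flim)) => n.
apply: rho_le => x _; rewrite /= extF ler_norml; have := uL n x; lra.
Qed.

(** The usual construction of nested closed balls: the ball of rank n + 1 has
    radius less than 1/(n+1) and is contained in F n. *)
Lemma C_lambda_Baire (F : (set (C_lambda R))^nat) :
  (forall i, open (F i)) -> (forall i, dense (F i)) -> dense (\bigcap_i F i).
Proof.
move=> oF dF D [f0 Df0] oD.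
have [r0 r00 f0D] := open_closed_ball oD Df0.
pose P n (p q : C_lambda R * {posnum R}) := q.2%:num < n.+1%:R^-1 /\
  forall g, rho q.1 g <= q.2%:num -> F n g /\ rho p.1 g <= p.2%:num.
have step (np : nat * (C_lambda R * {posnum R})) : exists q, P np.1 np.2 q.
  case: np => n [f r] /=.
  have oB : open [set g | rho f g < r%:num].
    apply/open_rhoP => g /= fg; exists (r%:num - rho f g).
      by rewrite subr_gt0.
    by move=> h gh; apply: le_lt_trans (rho_triangle g _ _) _; lra.
  have [|g [/= fg Fg]] := dF n _ _ oB; first by exists f => /=; rewrite rhoxx.
  have [s s0 gs] := open_closed_ball (openI oB (oF n)) (conj fg Fg).
  have m0 : 0 < Num.min s n.+2%:R^-1 by rewrite lt_min s0 invr_gt0 ltr0n.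
  exists (g, PosNum m0); split=> /=.
    by rewrite gt_min ltf_pV2 ?posrE// ltr_nat ltnSn orbT.
  move=> h; rewrite le_min => /andP[/gs[/= /ltW fh Fh] _].
  by split.
have [next nextP] := choice step.
pose fix s n := if n is m.+1 then next (m, s m) else (f0, PosNum r00).
have sP n : P n (s n) (s n.+1) by exact: (nextP (n, s n)).
have sB n m g : (n <= m)%N -> rho (s m).1 g <= (s m).2%:num ->
    rho (s n).1 g <= (s n).2%:num.
  elim: m => [|m IHm]; first by rewrite leqn0 => /eqP ->.
  rewrite leq_eqVlt => /predU1P[-> //|/IHm {}IHm] /((sP m).2)[_].
  exact: IHm.
have [||f sf] :=
  @C_lambda_complete (fun n => (s n).1) (fun n => (s n).2%:num).
- by move=> n m nm; apply: (sB _ m) => //; rewrite rhoxx.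
- move=> e e0; exists (Num.truncn e^-1).+1.
  apply: lt_trans (sP _).1 _.
  by rewrite -[ltRHS]invrK ltf_pV2 ?posrE ?invr_gt0// truncnS_gt.
- exists f; split; first by apply: f0D; exact: (sf 0).
  by move=> n _; have [] := (sP n).2 f (sf n.+1).
Qed.

End Uniform_distance.

(** * Images of segments, composition, and criteria for membership *)

Section Covering.
Context {R : realType}.
Implicit Types (p q x y z t e : R) (F G : R -> R) (f g h : C_lambda R).

(** For continuous F this says that F([p, q]) contains [p', q'], by
    [covers_IVT]; two points witness it, which makes it easy to check. *)
Definition covers F p q p' q' :=
  (exists2 u, p <= u <= q & F u <= p') /\
  (exists2 v, p <= v <= q & q' <= F v).

Lemma covers_IVT F p q p' q' z : continuous F -> covers F p q p' q' ->
  p' <= z <= q' -> exists2 x, p <= x <= q & F x = z.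
Proof.
move=> cF [[u upq Fu] [v vpq Fv]] zpq.
have sub x y : continuous F -> {within `[x, y], continuous F}.
  by move=> _; exact: continuous_subspaceT.
have [uv|/ltW vu] := leP u v.
  have [||c] := @IVT _ F u v z uv; first exact: sub.
    rewrite ge_min le_max; lra.
  by rewrite in_itv/= => cuv Fc; exists c => //; lra.
have [||c] := @IVT _ F v u z vu; first exact: sub.
  rewrite ge_min le_max; lra.
by rewrite in_itv/= => cuv Fc; exists c => //; lra.
Qed.

Lemma covers_comp F G p q p' q' p'' q'' : continuous G ->
  covers G p q p' q' -> covers F p' q' p'' q'' -> covers (F \o G) p q p'' q''.
Proof.
move=> cG Gpq [[u upq Fu] [v vpq Fv]].
have [x xpq Gx] := covers_IVT cG Gpq upq.
have [y ypq Gy] := covers_IVT cG Gpq vpq.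
by split; [exists x => //=; rewrite Gx|exists y => //=; rewrite Gy].
Qed.

Lemma eq_covers F G p q p' q' :
  F =1 G -> covers F p q p' q' -> covers G p q p' q'.
Proof. by move=> /funext ->. Qed.

Lemma ext_continuous f : continuous (ext f).
Proof. by apply: continuous_ext; exact: C_lambda_continuous. Qed.

(** A measure preserving map does not shorten segments: [p, q] is contained in
    the preimage of [min f, max f], whose measure is max f - min f. *)
Lemma exists_spread f p q : 0 <= p -> p <= q -> q <= 1 ->
  exists u v, [/\ p <= u <= q, p <= v <= q & q - p <= ext f v - ext f u].
Proof.
move=> p0 pq q1.
have cf : {within `[p, q], continuous (ext f)}.
  by apply: continuous_subspaceT; exact: ext_continuous.
have [v vpq fv] := EVT_max pq cf; have [u upq fu] := EVT_min pq cf.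
exists u, v; split;
  [by move: upq; rewrite in_itv|by move: vpq; rewrite in_itv|].
have uv : ext f u <= ext f v by exact: fv.
have cf' : continuous f by exact: C_lambda_continuous.
have mf := measurable_ext_segment (ext f u) (ext f v) cf'.
rewrite -lee_fin -lebesgue_segment//.
rewrite -(preserves_segment cf' (C_lambda_preserves f))//.
- apply: le_measure; rewrite ?inE; [exact: measurable_itv|exact: mf|].
  move=> x /=; rewrite in_itv/= => xpq; split; last by rewrite /= in_itv/=; lra.
  by rewrite /= in_itv/= fu ?fv// in_itv.
- by have /andP[] := ext_ge0_le1 f u.
- by have /andP[] := ext_ge0_le1 f v.
Qed.

Lemma ext_uniform_continuous f e : 0 < e -> exists2 d, 0 < d &
  forall x y, 0 <= x <= 1 -> `|y - x| < d -> `|ext f y - ext f x| < e.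
Proof.
move=> e0.
have /compact_near_coveringP cov := @segment_compact R 0 1.
have := cov R (0^'+)
  (fun d x => forall y, `|y - x| < d -> `|ext f y - ext f x| < e) _.
case=> [x _|d /= d0 fd].
  have /cvgrPdist_lt/(_ (e / 2) ltac:(lra)) := @ext_continuous f x.
  move=> /nbhs_ballP[r /= r0 fr].
  exists (ball x (r / 2), [set d | d < r / 2]) => /=.
    split; first by apply: nbhsx_ballx; lra.
    by apply: nbhs_right_lt; lra.
  move=> [z d] [/=]; rewrite /ball/= => xz dr y yz.
  have := fr z; have := fr y; rewrite /ball/=.
  move=> /(_ ltac:(move: xz yz; rewrite !ltr_norml; lra)) fy.
  move=> /(_ ltac:(move: xz yz; rewrite !ltr_norml; lra)) fz.
  by move: fy fz; rewrite !ltr_norml; lra.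
exists (d / 2); first lra.
move=> x y x01 xy; apply: (fd (d / 2)) => //=.
- by rewrite /ball/= sub0r normrN ger0_norm; lra.
- lra.
Qed.

Lemma preserves_comp f g : preserves_lambda (f \o g).
Proof.
move=> A bA; rewrite (C_lambda_preserves f)// (C_lambda_preserves g)//.
move: bA; apply: (@smallest_sub _ _ _ [set A | borel_unit (f @^-1` A)]).
  have [b0 bC bU] :=
    smallest_sigma_algebra setT [set U : set (unit_interval R) | open U].
  split=> /=; first by rewrite /borel_unit preimage_set0.
    by move=> B /bC; rewrite !setTD preimage_setC.
  by move=> F bF; rewrite preimage_bigcup; exact: bU.
move=> B oB /=; apply: open_borel_unit; apply: open_comp => // x _.
exact: C_lambda_continuous.
Qed.

Lemma continuous_C_comp f g : continuous (f \o g).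
Proof.
by move=> x; apply: continuous_comp; exact: C_lambda_continuous.
Qed.

Definition C_comp f g : C_lambda R :=
  MkC_lambda (@continuous_C_comp f g) (@preserves_comp f g).

Lemma ext_C_comp f g x : ext (C_comp f g) x = ext f (ext g x).
Proof. exact: ext_comp. Qed.

Lemma lebesgue_two_segments (a b c d : R) : a <= b -> b <= c -> c <= d ->
  lebesgue_measure (`[a, b] `|` `[c, d] : set R) = (b - a + (d - c))%:E.
Proof.
rewrite (le_eqVlt b c) => ab /predU1P[bc cd|bc cd].
  subst c.
  rewrite (_ : _ `|` _ = `[a, d]%classic).
    by rewrite lebesgue_segment; [congr EFin; lra|lra].
  apply/seteqP; split => x /=; rewrite !in_itv/=; first by move=> []; lra.
  by move=> xad; have [xb|bx] := leP x b; [left|right]; lra.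
rewrite measureU; last 3 first.
- exact: measurable_itv.
- exact: measurable_itv.
- by apply/seteqP; split => x //=; rewrite !in_itv/=; lra.
transitivity ((b - a)%:E + (d - c)%:E)%E => //.
by congr (_ + _)%E; rewrite -lebesgue_segment.
Qed.

(** The superlevel sets of the zigzags and folds below are unions of at most two
    segments, which is why two are enough here; a single segment is obtained with
    c = d. *)
Lemma C_lambda_of_levels F : continuous F ->
  (forall x, 0 <= x <= 1 -> 0 <= F x <= 1) ->
  (forall t, 0 <= t <= 1 -> exists a b c d : R,
    [/\ 0 <= a, a <= b, b <= c & c <= d] /\
    [/\ d <= 1, b - a + (d - c) = 1 - t &
     forall x, 0 <= x <= 1 -> t <= F x <-> a <= x <= b \/ c <= x <= d]) ->
  exists f, forall x, 0 <= x <= 1 -> ext f x = F x.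
Proof.
move=> cF F01 lF; pose f (u : unit_interval R) := clamp (F (val u)).
have extf x : 0 <= x <= 1 -> ext f x = F x.
  by move=> x01; rewrite /ext /f val_clamp val_clamp// F01.
have cf : continuous f.
  have cFv : continuous (F \o val : unit_interval R -> R).
    move=> u; apply: continuous_comp; last exact: cF.
    exact: continuous_unit_val.
  move=> u.
  apply: (@continuous_comp _ _ _ (F \o val : unit_interval R -> R) clamp).
    exact: cFv.
  exact: continuous_clamp.
suff pf : preserves_lambda f by exists (MkC_lambda cf pf).
apply: preserves_of_levels => // t t01.
have [a [b [c [d [[a0 ab bc cd] [d1 abcd Ft]]]]]] := lF _ t01.
rewrite -abcd -lebesgue_two_segments//; congr (lebesgue_measure _).
apply/seteqP; split => x /=; rewrite !in_itv/=.
  by move=> [+ x01]; rewrite extf// => /andP[tF _]; exact/(Ft x x01).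
move=> xI; have x01 : 0 <= x <= 1 by case: xI; lra.
split => //; rewrite extf//; apply/andP; split; first exact/(Ft x x01).
by have /andP[] := F01 x x01.
Qed.

End Covering.

(** * Zigzags and folds *)

Section Windows.
Context {R : realType}.
Implicit Types (a w s p q x y z t e : R) (f g h : C_lambda R).

(** The identity outside [a, a + w], and three affine laps of slope 3, -3, 3 of
    [a, a + w] onto itself inside.  The min-max form makes continuity automatic;
    [zigzagP] gives the affine pieces. *)
Definition zigzag a w x : R :=
  Num.min (Num.max (a + 3 * (x - a)) (Num.min x a))
    (Num.max (4 * a + 2 * w - 3 * x)
      (Num.min (a + w + 3 * (x - a - w)) (Num.max x (a + w)))).

(* Innermost comparisons are split first, so that no conditional is left inside
   a hypothesis. *)
Ltac minmax :=
  rewrite /Order.min /Order.max;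
  repeat match goal with
  | |- context [if (?x < ?y)%O then _ else _] =>
      lazymatch x with
      | context [if _ then _ else _] => fail
      | _ => lazymatch y with
             | context [if _ then _ else _] => fail
             | _ => case: (ltP x y) => ?; try (exfalso; lra)
             end
      end
  end; lra.

Lemma zigzag_out a w x : 0 < w -> x <= a \/ a + w <= x -> zigzag a w x = x.
Proof. by move=> w0 []; rewrite /zigzag; minmax. Qed.

Lemma zigzag_lap1 a w x : 0 < w -> a <= x <= a + w / 3 ->
  zigzag a w x = a + 3 * (x - a).
Proof. by move=> w0; rewrite /zigzag; minmax. Qed.

Lemma zigzag_lap2 a w x : 0 < w -> a + w / 3 <= x <= a + w - w / 3 ->
  zigzag a w x = 4 * a + 2 * w - 3 * x.
Proof. by move=> w0; rewrite /zigzag; minmax. Qed.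

Lemma zigzag_lap3 a w x : 0 < w -> a + w - w / 3 <= x <= a + w ->
  zigzag a w x = a + w + 3 * (x - a - w).
Proof. by move=> w0; rewrite /zigzag; minmax. Qed.

Lemma zigzagP a w x : 0 < w ->
  [\/ (x <= a \/ a + w <= x) /\ zigzag a w x = x,
     a <= x <= a + w / 3 /\ zigzag a w x = a + 3 * (x - a),
     a + w / 3 <= x <= a + w - w / 3 /\
       zigzag a w x = 4 * a + 2 * w - 3 * x |
     a + w - w / 3 <= x <= a + w /\
       zigzag a w x = a + w + 3 * (x - a - w)].
Proof.
move=> w0.
have /orP[xa|ax] := le_total x a.
  by apply: Or41; split; [left|apply: zigzag_out => //; left].
have /orP[x1|x1] := le_total x (a + w / 3).
  have xI : a <= x <= a + w / 3 by lra.
  by apply: Or42; split=> //; apply: zigzag_lap1.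
have /orP[x2|x2] := le_total x (a + w - w / 3).
  have xI : a + w / 3 <= x <= a + w - w / 3 by lra.
  by apply: Or43; split=> //; apply: zigzag_lap2.
have /orP[x3|x3] := le_total x (a + w).
  have xI : a + w - w / 3 <= x <= a + w by lra.
  by apply: Or44; split=> //; apply: zigzag_lap3.
have bx : a + w <= x by lra.
by apply: Or41; split; [right|apply: zigzag_out => //; right].
Qed.

Lemma zigzag_in a w x : 0 < w -> a <= x <= a + w -> a <= zigzag a w x <= a + w.
Proof. by move=> w0 xI; have := zigzagP a x w0; case=> -[]; lra. Qed.

Let continuous_affine (c k : R) : continuous (fun x => c + k * x).
Proof.
move=> x; apply: cvgD; first exact: cvg_cst.
by apply: cvgM; [exact: cvg_cst|exact: cvg_id].
Qed.

Let continuous_const (c : R) : continuous (fun _ : R => c).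
Proof. by move=> x; exact: cvg_cst. Qed.

Let continuous_idfun : continuous (fun x : R => x).
Proof. by move=> x; exact: cvg_id. Qed.

Lemma continuous_zigzag a w : continuous (zigzag a w).
Proof.
have -> : zigzag a w =
    ((fun x => (a - 3 * a) + 3 * x) \max (id \min (fun=> a))) \min
    ((fun x => (4 * a + 2 * w) + (- 3) * x) \max
      ((fun x => (a + w - 3 * (a + w)) + 3 * x) \min (id \max (fun=> a + w)))).
  apply/funext => x; rewrite /zigzag /=.
  by congr (Num.min (Num.max _ _) (Num.max _ (Num.min _ _))); lra.
move=> x; apply: continuous_min; apply: continuous_max.
- exact: continuous_affine.
- by apply: continuous_min; [exact: continuous_idfun|exact: continuous_const].
- exact: continuous_affine.
- apply: continuous_min; first exact: continuous_affine.
  by apply: continuous_max; [exact: continuous_idfun|exact: continuous_const].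
Qed.

(** For t in [a, a + w] the set where zigzag >= t consists of a piece around the
    top of the first two laps, of length 2w/3 - 2(t - a)/3, and of a piece
    [.., 1] starting on the third lap; together they have length 1 - t. *)
Lemma exists_zigzag a w : 0 < w -> 0 <= a -> a + w <= 1 ->
  exists h, forall x, 0 <= x <= 1 -> ext h x = zigzag a w x.
Proof.
move=> w0 a0 aw1; apply: C_lambda_of_levels; first exact: continuous_zigzag.
  by move=> x x01; have := zigzagP a x w0; case=> -[]; lra.
move=> t t01.
(* At t = a + w the top of the first lap belongs to the superlevel set, so this
   value goes with the zigzag range. *)
have [tab|atb] : (t <= a \/ a + w < t) \/ (a <= t <= a + w).
  have /orP[ta|ta] := le_total t a; first lra.
  by have [tb|tb] := leP t (a + w); lra.
  exists t, 1, 1, 1; split; split; [lra|lra|lra|lra|lra|lra|].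
  move=> x x01; split; last by have := zigzagP a x w0; case=> -[]; lra.
  by move=> tx; left; have := zigzagP a x w0; case=> -[]; lra.
exists (a + (t - a) / 3), (a + w - w / 3 - (t - a) / 3),
  (a + w - w / 3 + (t - a) / 3), 1.
split; split; [lra|lra|lra|lra|lra|lra|].
move=> x x01; split; last by have := zigzagP a x w0; case=> -[]; lra.
by have /orP[xm|mx] := le_total x (a + w - w / 3) => tx; [left|right];
  have := zigzagP a x w0; case=> -[]; lra.
Qed.

(** The measure preserving fold of [0, d]: down from d to 0 and back up with
    slopes -2 and 2, and the identity beyond d.  It sends 0 to d. *)
Definition fold d x : R := Num.max (d - 2 * x) (Num.min (2 * x - d) x).

Lemma foldP d x : 0 < d ->
  [\/ x <= d / 2 /\ fold d x = d - 2 * x,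
     d / 2 <= x <= d /\ fold d x = 2 * x - d |
     d <= x /\ fold d x = x].
Proof.
move=> d0; have /orP[x1|x1] := le_total x (d / 2).
  by apply: Or31; split=> //; rewrite /fold; minmax.
have /orP[x2|x2] := le_total x d.
  by apply: Or32; split; [lra|rewrite /fold; minmax].
by apply: Or33; split=> //; rewrite /fold; minmax.
Qed.

Lemma continuous_fold d : continuous (fold d).
Proof.
have -> : fold d =
    (fun x => d + (- 2) * x) \max ((fun x => - d + 2 * x) \min id).
  by apply/funext => x; rewrite /fold /=; congr (Num.max _ (Num.min _ _)); lra.
move=> x; apply: continuous_max; first exact: continuous_affine.
by apply: continuous_min; [exact: continuous_affine|exact: continuous_idfun].
Qed.

Lemma exists_fold0 d : 0 < d -> d <= 1 ->
  exists h, forall x, 0 <= x <= 1 -> ext h x = fold d x.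
Proof.
move=> d0 d1; apply: C_lambda_of_levels; first exact: continuous_fold.
  by move=> x x01; have := foldP x d0; case=> -[]; lra.
move=> t t01; have [td|dt] := leP t d.
  exists 0, ((d - t) / 2), ((d + t) / 2), 1.
  split; split; [lra|lra|lra|lra|lra|lra|].
  move=> x x01; split; last by have := foldP x d0; case=> -[]; lra.
  by have /orP[xm|mx] := le_total x (d / 2) => tx; [left|right];
    have := foldP x d0; case=> -[]; lra.
exists t, 1, 1, 1; split; split; [lra|lra|lra|lra|lra|lra|].
move=> x x01; split; last by have := foldP x d0; case=> -[]; lra.
by move=> tx; left; have := foldP x d0; case=> -[]; lra.
Qed.

Lemma exists_fold1 d : 0 < d -> d <= 1 ->
  exists h, forall x, 0 <= x <= 1 -> ext h x = 1 - fold d (1 - x).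
Proof.
move=> d0 d1; apply: C_lambda_of_levels.
- move=> x; apply: cvgB; first exact: cvg_cst.
  apply: (@continuous_comp _ _ _ (fun x => 1 - x) (fold d)).
    by apply: cvgB; [exact: cvg_cst|exact: cvg_id].
  exact: continuous_fold.
- by move=> x x01; have := foldP (1 - x) d0; case=> -[]; lra.
move=> t t01; have [td|dt] := leP t (1 - d).
  exists t, 1, 1, 1; split; split; [lra|lra|lra|lra|lra|lra|].
  move=> x x01; split; last by have := foldP (1 - x) d0; case=> -[]; lra.
  by move=> tx; left; have := foldP (1 - x) d0; case=> -[]; lra.
exists (1 - d / 2 - (1 - t) / 2), (1 - d / 2 + (1 - t) / 2),
  (1 - d / 2 + (1 - t) / 2), (1 - d / 2 + (1 - t) / 2).
split; split; [lra|lra|lra|lra|lra|lra|].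
move=> x x01; split; last by have := foldP (1 - x) d0; case=> -[]; lra.
by move=> tx; left; have := foldP (1 - x) d0; case=> -[]; lra.
Qed.

End Windows.

(** * Maps near the identity that lengthen segments *)

Section Sawtooth.
Context {R : realType}.
Implicit Types (a w s p q x y z t e : R) (f g h : C_lambda R).

Lemma preserves_id : preserves_lambda (@id (unit_interval R)).
Proof. by []. Qed.

Lemma continuous_id_unit : continuous (@id (unit_interval R)).
Proof. by move=> x; exact: cvg_id. Qed.

Definition C_id : C_lambda R := MkC_lambda continuous_id_unit preserves_id.

Lemma ext_C_id x : 0 <= x <= 1 -> ext C_id x = x.
Proof. exact: val_clamp. Qed.

Lemma locate_block s w x n : 0 < w ->
  [\/ x <= s, s + n%:R * w <= x |
      exists2 j, (j < n)%N & s + j%:R * w <= x <= s + j%:R * w + w].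
Proof.
move=> w0; elim: n => [|n [xs|sx|[j jn xj]]].
- have /orP[xs|sx] := le_total x s; first exact: Or31.
  by apply: Or32; rewrite mul0r addr0.
- exact: Or31.
- have /orP[xn|nx] := le_total x (s + n%:R * w + w).
    by apply: Or33; exists n => //; rewrite sx.
  by apply: Or32; rewrite -natr1; lra.
- by apply: Or33; exists j => //; exact: ltnW.
Qed.

(** A zigzag on each of n consecutive blocks of length w starting at s, and the
    identity elsewhere. *)
Definition comb s w n h := [/\ 0 < w, 0 <= s, s + n%:R * w <= 1,
  (forall x, 0 <= x <= 1 -> x <= s \/ s + n%:R * w <= x -> ext h x = x) &
  (forall j x, (j < n)%N -> s + j%:R * w <= x <= s + j%:R * w + w ->
     ext h x = zigzag (s + j%:R * w) w x)].

(** A comb with n + 1 teeth is a comb with n teeth after one zigzag: each of the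
    two maps fixes the blocks that the other one moves. *)
Lemma exists_comb s w n : 0 < w -> 0 <= s -> s + n%:R * w <= 1 ->
  exists h, comb s w n h.
Proof.
move=> w0 s0; elim: n => [sn1|n IHn sn1'].
  by exists C_id; split => // x x01 _; rewrite ext_C_id.
have sn1 := sn1'; move: sn1; rewrite -natr1 => sn1.
have nw0 : 0 <= n%:R * w by rewrite mulr_ge0// ltW.
have [|h [_ _ _ hout hin]] := IHn; first lra.
have [||g gz] := @exists_zigzag R (s + n%:R * w) w w0; [lra|lra|].
exists (C_comp h g); split => // [x x01|j x]; rewrite ext_C_comp.
  rewrite -natr1 => xo.
  have -> : ext g x = x by rewrite gz// zigzag_out//; case: xo; lra.
  by apply: hout => //; case: xo; lra.
rewrite ltnS leq_eqVlt => /predU1P[->|jn] xj.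
  have x01 : 0 <= x <= 1 by lra.
  have := zigzag_in w0 xj; rewrite gz// => zI.
  by apply: hout; [lra|right; lra].
have jw0 : 0 <= j%:R * w by rewrite mulr_ge0// ltW.
have jnw : j%:R * w + w <= n%:R * w.
  by rewrite -{2}(mul1r w) -mulrDl natr1 ler_pM2r// ler_nat.
have x01 : 0 <= x <= 1 by lra.
by rewrite gz// zigzag_out//; [exact: hin|left; lra].
Qed.

Lemma comb_near s w n h x : comb s w n h -> 0 <= x <= 1 -> `|ext h x - x| <= w.
Proof.
move=> [w0 s0 sn1 hout hin] x01.
have [xs|sx|[j jn xj]] := locate_block s x n w0.
- by rewrite hout//; [rewrite subrr normr0 ltW|left].
- by rewrite hout//; [rewrite subrr normr0 ltW|right].
- by rewrite (hin _ _ jn xj); have := zigzag_in w0 xj; rewrite ler_norml; lra.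
Qed.

(** The first lap of the block [a, a + w] containing q rises from a with slope 3,
    and since p + w <= q it starts inside [p, q].  So [p, q] contains either a
    point sent to a + w, or q itself on the first lap, where the value a + 3 (q - a)
    exceeds q by 2 (q - a). *)
Lemma comb_gain_right s w n h j p q : comb s w n h -> (j < n)%N -> p + w <= q ->
  s + j%:R * w <= q <= s + j%:R * w + w ->
  exists2 u, p <= u <= q & q <= ext h u /\
    (s + j%:R * w + w / 8 <= q ->
     s + j%:R * w + w <= ext h u \/ q + w / 4 <= ext h u).
Proof.
move=> [w0 s0 sn1 hout hin] jn pq qj.
have := hin j _ jn; move: (s + j%:R * w) qj => a qj {}hin.
have /orP[q1|q1] := le_total q (a + w / 3).
  exists q; first lra.
  by rewrite hin// zigzag_lap1//; [split; [lra|right; lra]|lra].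
exists (a + w / 3); first lra.
by rewrite hin ?zigzag_lap1//; [split; [lra|left; lra]|lra|lra].
Qed.

(** Mirror image of [comb_gain_right], with the third lap. *)
Lemma comb_gain_left s w n h j p q : comb s w n h -> (j < n)%N -> p + w <= q ->
  s + j%:R * w <= p <= s + j%:R * w + w ->
  exists2 u, p <= u <= q & ext h u <= p /\
    (p <= s + j%:R * w + w - w / 8 ->
     ext h u <= s + j%:R * w \/ ext h u <= p - w / 4).
Proof.
move=> [w0 s0 sn1 hout hin] jn pq qj.
have := hin j _ jn; move: (s + j%:R * w) qj => a qj {}hin.
have /orP[p1|p1] := le_total (a + w - w / 3) p.
  exists p; first lra.
  by rewrite hin// zigzag_lap3//; [split; [lra|right; lra]|lra].
exists (a + w - w / 3); first lra.
by rewrite hin ?zigzag_lap3//; [split; [lra|left; lra]|lra|lra].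
Qed.

Lemma comb_right s w n h p q : comb s w n h -> 0 <= p -> q <= 1 -> p + w <= q ->
  exists2 u, p <= u <= q & q <= ext h u.
Proof.
move=> hc p0 q1 pq; have [w0 s0 sn1 hout hin] := hc.
have [xs|sx|[j jn xj]] := locate_block s q n w0.
- by exists q; [lra|rewrite hout//; [lra|left]].
- by exists q; [lra|rewrite hout//; [lra|right]].
- by have [u upq [qu _]] := comb_gain_right hc jn pq xj; exists u.
Qed.

Lemma comb_left s w n h p q : comb s w n h -> 0 <= p -> q <= 1 -> p + w <= q ->
  exists2 u, p <= u <= q & ext h u <= p.
Proof.
move=> hc p0 q1 pq; have [w0 s0 sn1 hout hin] := hc.
have [xs|sx|[j jn xj]] := locate_block s p n w0.
- by exists p; [lra|rewrite hout//; [lra|left]].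
- by exists p; [lra|rewrite hout//; [lra|right]].
- by have [u upq [qu _]] := comb_gain_left hc jn pq xj; exists u.
Qed.

(** The blocks of the two combs are shifted by half a block, so each point of
    [w, 1 - w] is at distance at least w/4 from the ends of a block of one of them. *)
Lemma centered_block w M x : 0 < w -> M.+1%:R * w = 1 -> w <= x <= 1 - w ->
  (exists2 j, (j < M.+1)%N &
     0 + j%:R * w + w / 4 <= x <= 0 + j%:R * w + w - w / 4) \/
  (exists2 j, (j < M)%N &
     w / 2 + j%:R * w + w / 4 <= x <= w / 2 + j%:R * w + w - w / 4).
Proof.
move=> w0 Mw xI.
have [x0|x1|[j jM xj]] := locate_block 0 x M.+1 w0; [lra|lra|].
have [xl|xl] := ltP x (0 + j%:R * w + w / 4).
  right; case: j jM xj xl => [|j] jM; first by rewrite mul0r; lra.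
  by rewrite -natr1 => xj xl; exists j => //; lra.
have [xr|xr] := ltP (0 + j%:R * w + w - w / 4) x; last first.
  by left; exists j => //; lra.
right; exists j; last lra.
have : j%:R * w < M%:R * w by move: Mw; rewrite -natr1; lra.
by rewrite ltr_pM2r// ltr_nat.
Qed.

(** If q is well inside a block of h1, then h1 already pushes it to the right by
    w/4 and h0 does not pull it back.  Otherwise q is well inside a block of h0,
    whose right end is at least q + w/4; after h1 the right endpoint is still in
    that block, and at distance at least w/8 from its left end, or it has passed
    the block altogether.  The left endpoint a after h1 is arbitrary, since it is
    chosen independently in [two_combs]. *)
Lemma two_combs_right w M h0 h1 p q : M.+1%:R * w = 1 ->
  comb 0 w M.+1 h0 -> comb (w / 2) w M h1 ->
  0 <= p -> p + w <= q -> w <= q <= 1 - w ->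
  exists2 u1, p <= u1 <= q & q <= ext h1 u1 /\ forall a, 0 <= a <= p ->
    exists2 u0, a <= u0 <= ext h1 u1 & q + w / 4 <= ext h0 u0.
Proof.
move=> Mw c0 c1 p0 pq qI; have w0 : 0 < w by case: c0.
have q1 : q <= 1 by lra.
have [[j jM qj]|[j jM qj]] := centered_block w0 Mw qI; last first.
  have [|u1 u1I [u1q ugain]] := comb_gain_right c1 jM pq; first lra.
  exists u1 => //; split=> // a a01; have uI := ext_ge0_le1 h1 u1.
  have [|||u0 u0I u0q] := @comb_right _ _ _ _ a (ext h1 u1) c0;
    [lra|lra|lra|].
  by exists u0 => //; have [||] := ugain; lra.
have [u1 u1I u1q] := comb_right c1 p0 q1 pq.
exists u1 => //; split=> // a a01; have uI := ext_ge0_le1 h1 u1.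
have /orP[ub|bu] := le_total (ext h1 u1) (0 + j%:R * w + w).
  have [||u0 u0I [_ u0gain]] := @comb_gain_right _ _ _ _ j a (ext h1 u1) c0 jM;
    [lra|lra|].
  by exists u0 => //; have [||] := u0gain; lra.
have [|||u0 u0I u0q] := @comb_right _ _ _ _ a (ext h1 u1) c0;
    [lra|lra|lra|].
by exists u0 => //; lra.
Qed.

Lemma two_combs_left w M h0 h1 p q : M.+1%:R * w = 1 ->
  comb 0 w M.+1 h0 -> comb (w / 2) w M h1 ->
  q <= 1 -> p + w <= q -> w <= p <= 1 - w ->
  exists2 u1, p <= u1 <= q & ext h1 u1 <= p /\ forall b, q <= b <= 1 ->
    exists2 u0, ext h1 u1 <= u0 <= b & ext h0 u0 <= p - w / 4.
Proof.
move=> Mw c0 c1 q1 pq pI; have w0 : 0 < w by case: c0.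
have p0 : 0 <= p by lra.
have [[j jM pj]|[j jM pj]] := centered_block w0 Mw pI; last first.
  have [|u1 u1I [u1p ugain]] := comb_gain_left c1 jM pq; first lra.
  exists u1 => //; split=> // b b01; have uI := ext_ge0_le1 h1 u1.
  have [|||u0 u0I u0q] := @comb_left _ _ _ _ (ext h1 u1) b c0;
    [lra|lra|lra|].
  by exists u0 => //; have [||] := ugain; lra.
have [u1 u1I u1p] := comb_left c1 p0 q1 pq.
exists u1 => //; split=> // b b01; have uI := ext_ge0_le1 h1 u1.
have /orP[ub|bu] := le_total (0 + j%:R * w) (ext h1 u1).
  have [||u0 u0I [_ u0gain]] := @comb_gain_left _ _ _ _ j (ext h1 u1) b c0 jM;
    [lra|lra|].
  by exists u0 => //; have [||] := u0gain; lra.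
have [|||u0 u0I u0q] := @comb_left _ _ _ _ (ext h1 u1) b c0;
    [lra|lra|lra|].
by exists u0 => //; lra.
Qed.

Lemma two_combs w M h0 h1 p q : M.+1%:R * w = 1 ->
  comb 0 w M.+1 h0 -> comb (w / 2) w M h1 ->
  0 <= p -> q <= 1 -> p + w <= q -> q <= 1 - w \/ w <= p ->
  exists p' q', covers (ext (C_comp h0 h1)) p q p' q' /\
    [/\ 0 <= p', p' <= q', q' <= 1 & q - p + w / 4 <= q' - p'].
Proof.
move=> Mw c0 c1 p0 q1 pq npq; have w0 : 0 < w by case: c0.
have fin v1 u1 v0 u0 : p <= v1 <= q -> p <= u1 <= q ->
    ext h1 v1 <= v0 <= ext h1 u1 -> ext h1 v1 <= u0 <= ext h1 u1 ->
    q - p + w / 4 <= ext h0 u0 - ext h0 v0 ->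
  exists p' q', covers (ext (C_comp h0 h1)) p q p' q' /\
    [/\ 0 <= p', p' <= q', q' <= 1 & q - p + w / 4 <= q' - p'].
  move=> v1I u1I v0I u0I gain; exists (ext h0 v0), (ext h0 u0); split.
    apply: (@eq_covers _ (ext h0 \o ext h1)).
      by move=> x; rewrite ext_C_comp.
    apply: (@covers_comp _ _ _ p q (ext h1 v1) (ext h1 u1)).
    - exact: ext_continuous.
    - by split; [exists v1|exists u1].
    - by split; [exists v0|exists u0].
  have := ext_ge0_le1 h0 v0; have := ext_ge0_le1 h0 u0.
  by split; lra.
have [v1 v1I v1p] := comb_left c1 p0 q1 pq.
have [u1 u1I u1q] := comb_right c1 p0 q1 pq.
case: npq => [qw|pw].
  have [|{}u1 {}u1I [{}u1q ugain]] := two_combs_right Mw c0 c1 p0 pq;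
    first lra.
  have v01 := ext_ge0_le1 h1 v1; have u01 := ext_ge0_le1 h1 u1.
  have [|u0 u0I u0q] := ugain (ext h1 v1); first lra.
  have [|||v0 v0I v0p] := @comb_left _ _ _ _ (ext h1 v1) (ext h1 u1) c0;
    [lra|lra|lra|].
  by apply: (fin v1 u1 v0 u0) => //; lra.
have [|{}v1 {}v1I [{}v1p vgain]] := two_combs_left Mw c0 c1 q1 pq; first lra.
have v01 := ext_ge0_le1 h1 v1; have u01 := ext_ge0_le1 h1 u1.
have [|v0 v0I v0p] := vgain (ext h1 u1); first lra.
have [|||u0 u0I u0q] := @comb_right _ _ _ _ (ext h1 v1) (ext h1 u1) c0;
  [lra|lra|lra|].
by apply: (fin v1 u1 v0 u0) => //; lra.
Qed.

Lemma exists_expanding M : exists h,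
  (forall x, 0 <= x <= 1 -> `|ext h x - x| <= 2 * M.+1%:R^-1) /\
  forall p q, 0 <= p -> q <= 1 -> p + M.+1%:R^-1 <= q ->
    q <= 1 - M.+1%:R^-1 \/ M.+1%:R^-1 <= p ->
    exists p' q', covers (ext h) p q p' q' /\
    [/\ 0 <= p', p' <= q', q' <= 1 & q - p + M.+1%:R^-1 / 4 <= q' - p'].
Proof.
set w : R := M.+1%:R^-1.
have w0 : 0 < w by rewrite invr_gt0 ltr0n.
have Mw : M.+1%:R * w = 1 by rewrite mulfV// pnatr_eq0.
have Mw' : M%:R * w + w = 1 by move: Mw; rewrite -natr1; lra.
have [||h0 c0] := @exists_comb 0 w M.+1 w0; [lra|lra|].
have [||h1 c1] := @exists_comb (w / 2) w M w0; [lra|lra|].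
exists (C_comp h0 h1); split => [x x01|p q p0 q1 pq npq].
  rewrite ext_C_comp; have := comb_near c1 x01.
  have := comb_near c0 (ext_ge0_le1 h1 x); rewrite !ler_norml; lra.
exact: (two_combs Mw c0 c1).
Qed.

End Sawtooth.

(** * The residual set *)

Section Typical.
Context {R : realType}.
Implicit Types (a w s p q x y z t e : R) (f g h : C_lambda R).

Definition expands w f := exists2 c, 0 < c &
  forall p q, 0 <= p -> q <= 1 -> p + w <= q -> q <= 1 - w \/ w <= p ->
    exists u v,
      [/\ p <= u <= q, p <= v <= q & q - p + c <= ext f v - ext f u].

Lemma open_expands w : open [set f | expands w f].
Proof.
apply/open_rhoP => f [c c0 fc]; exists (c / 4); first lra.
move=> g fg; exists (c / 2); first lra.
move=> p q p0 q1 pq npq; have [u [v [upq vpq uv]]] := fc p q p0 q1 pq npq.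
exists u, v; split => //.
have := le_rho f g u; have := le_rho f g v; rewrite !ler_norml; lra.
Qed.

Lemma rho_comp_near f e : 0 < e -> exists2 d, 0 < d &
  forall h, (forall x, 0 <= x <= 1 -> `|ext h x - x| < d) ->
    rho f (C_comp f h) < e.
Proof.
move=> e0; have [d d0 fd] := @ext_uniform_continuous R f (e / 2) ltac:(lra).
exists d => // h hd; apply: (@le_lt_trans _ _ (e / 2)); last lra.
apply: rho_le => x x01; rewrite ext_C_comp distrC; apply: ltW; apply: fd => //.
exact: hd.
Qed.

Lemma exists_invS e : 0 < e -> exists M : nat, M.+1%:R^-1 < e.
Proof.
move=> e0; exists (Num.truncn e^-1).
by rewrite -[ltRHS]invrK ltf_pV2 ?posrE ?invr_gt0// truncnS_gt.
Qed.

(** Density is always obtained by perturbing on the right: f o h is close to f,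
    by uniform continuity of f, as soon as h is close to the identity. *)
Lemma dense_of_comp (U : set (C_lambda R)) :
  (forall f (d : R), 0 < d -> exists2 h : C_lambda R,
     (forall x, 0 <= x <= 1 -> `|ext h x - x| < d) & U (C_comp f h)) ->
  dense U.
Proof.
move=> Uh D [f Df] /open_rhoP/(_ _ Df)[e e0 fD].
have [d d0 fd] := rho_comp_near f e0.
have [h hd Ufh] := Uh f d d0.
by exists (C_comp f h); split=> //; apply: fD; exact: fd.
Qed.

(** A lengthening h near the identity serves every f, because f does not shorten
    the image under h of a segment. *)
Lemma dense_expands w : 0 < w -> dense [set f | expands w f].
Proof.
move=> w0; apply: dense_of_comp => f d d0.
have [|M Mdw] := @exists_invS (Num.min (d / 2) w).
  by rewrite lt_min w0 divr_gt0.
move: Mdw; rewrite lt_min => /andP[Md Mw].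
have [h [hd hexp]] := @exists_expanding R M.
have : 0 < M.+1%:R^-1 :> R by rewrite invr_gt0 ltr0n.
move: (M.+1%:R^-1) Md Mw hd hexp => m Md Mw hd hexp m0.
exists h; first by move=> x /hd; lra.
exists (m / 4); first lra.
move=> p q p0 q1 pq npq.
have [||p' [q' [hpq [p'0 pq' q'1 gain]]]] := hexp p q p0 q1;
  [lra|by case: npq => ?; [left|right]; lra|].
have [u [v [upq vpq uv]]] := exists_spread f p'0 pq' q'1.
have [x xpq hx] := covers_IVT (@ext_continuous _ h) hpq upq.
have [y ypq hy] := covers_IVT (@ext_continuous _ h) hpq vpq.
by exists x, y; split => //; rewrite !ext_C_comp hx hy; lra.
Qed.

(** The length of the image grows by c at each step and is at most 1, so the
    exceptional case of [expands] is reached after at most (1 - (q - p)) / c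
    steps. *)
Lemma expands_iter w f p q : expands w f -> 0 <= p -> q <= 1 -> p + w <= q ->
  exists n, covers (ext (iter n f)) p q w (1 - w).
Proof.
move=> [c c0 fc] p0 q1 pq.
have [k] : exists k : nat, 1 - (q - p) < k%:R * c.
  exists (Num.truncn ((1 - (q - p)) / c)).+1.
  by rewrite -ltr_pdivrMr// truncnS_gt.
elim: k p q p0 q1 pq => [|k IHk] p q p0 q1 pq; first by rewrite mul0r; lra.
rewrite -natr1 => kpq.
have extid x : 0 <= x <= 1 -> ext id x = x by exact: val_clamp.
have [npq|/andP[pw qw]] : (q <= 1 - w \/ w <= p) \/ (p <= w) && (1 - w <= q).
  have /orP[|pw] := le_total w p; first by left; right.
  have /orP[|qw] := le_total q (1 - w); first by left; left.
  by right; rewrite pw.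
- have [u [v [upq vpq uv]]] := fc p q p0 q1 pq npq.
  have u01 := ext_ge0_le1 f u; have v01 := ext_ge0_le1 f v.
  have [||||n nI] := IHk (ext f u) (ext f v); [lra|lra|lra|lra|].
  exists n.+1; apply: (@eq_covers _ (ext (iter n f) \o ext f)).
    by move=> x; rewrite -[LHS]ext_comp /ext iterSr.
  apply: covers_comp nI; first exact: ext_continuous.
  by split; [exists u|exists v].
- exists 0; split; [exists p|exists q]; rewrite ?extid//=; lra.
Qed.

Definition inner_at a f := 0 < ext f a < 1.

Lemma open_inner_at a : open [set f | inner_at a f].
Proof.
apply/open_rhoP => f /= /andP[fa0 fa1].
exists (Num.min (ext f a) (1 - ext f a)); first by rewrite lt_min; lra.
move=> g; rewrite lt_min /inner_at.
by have := le_rho f g a; rewrite ler_norml; lra.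
Qed.

(** f takes two different values on [p, q], hence also their midpoint. *)
Lemma exists_interior_value f p q : 0 <= p -> p < q -> q <= 1 ->
  exists2 x, p <= x <= q & 0 < ext f x < 1.
Proof.
move=> p0 pq q1; have [u [v [upq vpq uv]]] := exists_spread f p0 (ltW pq) q1.
have [|||x xpq fx] := @covers_IVT R (ext f) p q (ext f u) (ext f v)
  ((ext f u + ext f v) / 2).
- exact: ext_continuous.
- by split; [exists u|exists v].
- by lra.
exists x => //; rewrite fx.
by have := ext_ge0_le1 f u; have := ext_ge0_le1 f v; lra.
Qed.

(** The fold sends 0 to a nearby point x at which f is neither 0 nor 1. *)
Lemma dense_inner_at0 : dense [set f | inner_at 0 f].
Proof.
apply: dense_of_comp => f d d0; pose m := Num.min (d / 2) 1.
have [m0 md m1] : [/\ 0 < m, m <= d / 2 & m <= 1].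
  by rewrite /m; case: (lerP (d / 2) 1) => ?; split; lra.
have [|||x xm fx] := @exists_interior_value f (m / 2) m; [lra|lra|lra|].
have [||h hx] := @exists_fold0 R x; [lra|lra|].
have x0 : 0 < x by lra.
exists h; last first.
  rewrite /= /inner_at ext_C_comp hx ?lexx ?ler01//.
  by have := foldP 0 x0; case=> -[? ->]; [rewrite mulr0 subr0|lra|lra].
move=> y y01; rewrite hx//; have := foldP y x0; rewrite ltr_norml.
by case=> -[? ->]; lra.
Qed.

Lemma dense_inner_at1 : dense [set f | inner_at 1 f].
Proof.
apply: dense_of_comp => f d d0; pose m := Num.min (d / 2) 1.
have [m0 md m1] : [/\ 0 < m, m <= d / 2 & m <= 1].
  by rewrite /m; case: (lerP (d / 2) 1) => ?; split; lra.
have [|||x xm fx] := @exists_interior_value f (1 - m) (1 - m / 2);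
  [lra|lra|lra|].
have [||h hx] := @exists_fold1 R (1 - x); [lra|lra|].
have x0 : 0 < 1 - x by lra.
exists h; last first.
  rewrite /= /inner_at ext_C_comp hx ?lexx ?ler01// subrr.
  by have := foldP 0 x0; case=> -[? ->]; [rewrite mulr0 subr0 subKr|lra|lra].
move=> y y01; rewrite hx//; have := foldP (1 - y) x0; rewrite ltr_norml.
by case=> -[? ->]; lra.
Qed.

(** f is onto since it does not shorten [0, 1]; as the endpoints are not sent to 0
    or 1, these values are taken at interior points. *)
Lemma inner_ends_covers f : inner_at 0 f -> inner_at 1 f ->
  exists2 w, 0 < w & forall w', w' <= w -> covers (ext f) w' (1 - w') 0 1.
Proof.
move=> f0 f1.
have [u [v [u01 v01 uv]]] :=
  @exists_spread R f 0 1 (lexx _) (@ler01 _) (lexx _).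
have fu := ext_ge0_le1 f u; have fv := ext_ge0_le1 f v.
have inner x : 0 <= x <= 1 -> ext f x = 0 \/ ext f x = 1 -> 0 < x < 1.
  move=> /andP[]; rewrite !le_eqVlt => /predU1P[<-|x0] /predU1P[x1|x1] fx.
  - by move: x1; lra.
  - by move: f0; rewrite /inner_at; case: fx => ->; lra.
  - by move: f1; rewrite /inner_at -x1; case: fx => ->; lra.
  - by lra.
have uI : 0 < u < 1 by apply: inner => //; left; lra.
have vI : 0 < v < 1 by apply: inner => //; right; lra.
exists (Num.min (Num.min u (1 - u)) (Num.min v (1 - v))).
  by rewrite !lt_min; lra.
move=> w; rewrite !le_min => wuv; split; [exists u|exists v]; lra.
Qed.

Lemma exists_segment_near a r : 0 <= a <= 1 -> 0 < r ->
  exists p q,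
    [/\ 0 <= p, p < q, q <= 1 & forall x, p <= x <= q -> `|a - x| < r].
Proof.
move=> a01 r0; pose m := Num.min (1 / 2) (r / 2).
have [m0 m1 mr] : [/\ 0 < m, m <= 1 / 2 & m <= r / 2].
  by rewrite lt_min !ge_min !lexx orbT; split => //; lra.
have [ha|ha] := leP a (1 / 2).
  exists a, (a + m).
  by split; [lra|lra|lra|move=> x xI; rewrite ltr_norml; lra].
exists (a - m), a.
by split; [lra|lra|lra|move=> x xI; rewrite ltr_norml; lra].
Qed.

Lemma open_contains_segment (U : set (unit_interval R)) : open U -> U !=set0 ->
  exists p q,
    [/\ 0 <= p, p < q, q <= 1 & forall x, p <= x <= q -> U (clamp x)].
Proof.
move=> [B oB <-] [u Bu].
have /nbhs_ballP[r /= r0 rB] := open_nbhs_nbhs (conj oB Bu).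
have [p [q [p0 pq q1 pqr]]] := exists_segment_near (unit_ge0_le1 u) r0.
exists p, q; split => // x xpq.
have x01 : 0 <= x <= 1 by lra.
suff: ball (val u) r (val (clamp x)) by exact: rB.
by rewrite (val_clamp x01); exact: pqr.
Qed.

Lemma leo_of_expands f : (forall N : nat, expands N.+1%:R^-1 f) ->
  inner_at 0 f -> inner_at 1 f -> leo f.
Proof.
move=> fexp f0 f1 U oU U0.
have [p [q [p0 pq q1 UI]]] := open_contains_segment oU U0.
have [w w0 fw] := inner_ends_covers f0 f1.
have [|N] := @exists_invS (Num.min w (q - p)).
  by rewrite lt_min w0 subr_gt0.
rewrite lt_min => /andP[Nw Npq].
have [|n nI] := expands_iter (fexp N) p0 q1.
  by rewrite -lerBrDl ltW.
have cn : continuous (ext (iter n f)).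
  elim: n {nI} => [|n IHn]; first by apply: continuous_ext => x; exact: cvg_id.
  have -> : ext (iter n.+1 f) = ext f \o ext (iter n f).
    by apply/funext => x /=; rewrite -ext_comp.
  move=> x; apply: continuous_comp; [exact: IHn|exact: ext_continuous].
have cov := covers_comp cn nI (fw _ (ltW Nw)).
exists n.+1; rewrite -subTset => y _.
have cSn : continuous (ext f \o ext (iter n f)).
  by move=> x; apply: continuous_comp; [exact: cn|exact: ext_continuous].
have [x xpq fx] := covers_IVT cSn cov (unit_ge0_le1 y).
exists (clamp x); first exact: UI.
by apply: val_inj; rewrite -fx /= -ext_comp.
Qed.

End Typical.

Theorem theorem9 (R : realType) :
  exists G : set (C_lambda R),
    [/\ Gdelta G, dense G & forall f : C_lambda R, G f -> leo f].
Proof.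
pose F n := match n with
  | 0 => [set f : C_lambda R | inner_at 0 f]
  | 1 => [set f | inner_at 1 f]
  | N.+2 => [set f | expands N.+1%:R^-1 f]
  end.
have oF n : open (F n).
  by case: n => [|[|N]];
    [exact: open_inner_at|exact: open_inner_at|exact: open_expands].
exists (\bigcap_n F n); split; first by exists F.
  apply: C_lambda_Baire => // -[|[|N]].
  - exact: dense_inner_at0.
  - exact: dense_inner_at1.
  - by apply: dense_expands; rewrite invr_gt0 ltr0n.
move=> f Gf; apply: leo_of_expands => [N||];
  [exact: (Gf N.+2)|exact: (Gf 0)|exact: (Gf 1)].
Qed.
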